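(* Let $\mathfrak{A}$ be a unital $C^*$-algebra and $a\in\mathfrak{A}$. Then $$dw_{\mathfrak{A}}^2(a)\leq\left(w_{\mathfrak{A}}(|a|^4+|a|^8)+2w_{\mathfrak{A}}^2(|a|^2a)\right)^{\frac{1}{2}}.$$
   Context: $\mathfrak{A}$ is a complex, nonzero, unital $C^*$-algebra with unit $\boldsymbol{1}$; its state space $\mathfrak{S}(\mathfrak{A})$ is the set of all positive linear functionals $f\in\mathfrak{A}^*$ with $\|f\|=f(\boldsymbol{1})=1$. For $a\in\mathfrak{A}$: $|a|=(a^*a)^{1/2}$; the algebraic numerical radius is $w_{\mathfrak{A}}(a)=\sup\{|f(a)|:f\in\mathfrak{S}(\mathfrak{A})\}$; the algebraic Davis--Wielandt radius is $dw_{\mathfrak{A}}(a)=\sup\{\sqrt{|f(a)|^2+f(a^*a)^2}:f\in\mathfrak{S}(\mathfrak{A})\}$. Powers outside mean $dw_{\mathfrak{A}}^2(a)=(dw_{\mathfrak{A}}(a))^2$, $w_{\mathfrak{A}}^2(b)=(w_{\mathfrak{A}}(b))^2$. *)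

(* Defs.v *)
From HB Require Import structures.
From mathcomp Require Import all_boot all_order all_algebra.
From mathcomp Require Import all_classical all_reals all_analysis.
From mathcomp Require Export complex.
Import Order.TTheory GRing.Theory Num.Theory.

Set Implicit Arguments.
Unset Strict Implicit.
Unset Printing Implicit Defensive.

Local Open Scope classical_set_scope.
Local Open Scope complex_scope.
Local Open Scope ring_scope.

(* [`|z|] is the modulus of [z] as an element of [R[i]]; here it is a real. *)
Definition modulus (R : realType) (z : R[i]) : R := complex.Re `|z|.

(* The carrier is an [algType], so the algebra is unital with [1 != 0].
   The norm is a field of the mixin because the libraries have no join of
   [algType] and [normedModType] (and HB refuses to add one downstream of
   [numDomainType]); [cnorm_complete] is completeness in that norm. *)
HB.mixin Record isCStarAlgebra (R : realType) (A : Type)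
    of GRing.Algebra R[i] A := {
  cnorm : A -> R;
  cnorm_eq0 : forall x : A, cnorm x = 0 -> x = 0;
  cnormD : forall x y : A, cnorm (x + y) <= cnorm x + cnorm y;
  cnormZ : forall (c : R[i]) (x : A), cnorm (c *: x) = modulus c * cnorm x;
  cnormM : forall x y : A, cnorm (x * y) <= cnorm x * cnorm y;
  cnorm_complete : forall u : nat -> A,
    (forall e : R, 0 < e -> exists N : nat, forall m n : nat,
       (N <= m)%N -> (N <= n)%N -> cnorm (u m - u n) < e) ->
    exists l : A, forall e : R, 0 < e -> exists N : nat, forall n : nat,
       (N <= n)%N -> cnorm (u n - l) < e;
  star : A -> A;
  starK : involutive star;
  starD : {morph star : x y / x + y};
  starZ : forall (c : R[i]) (x : A), star (c *: x) = Num.conj c *: star x;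
  starM : forall x y : A, star (x * y) = star y * star x;
  cnorm_star : forall x : A, cnorm (star x * x) = cnorm x ^+ 2
}.

#[short(type="cstarAlgType")]
HB.structure Definition CStarAlgebra (R : realType) :=
  {A of isCStarAlgebra R A & GRing.Algebra R[i] A}.

Section CStar.
Variables (R : realType) (A : cstarAlgType R).

Definition positive (b : A) : Prop := exists c : A, b = star c * c.

(* The square root of a positive element is its unique positive square root;
   [0] is a junk value for elements having none. *)
Definition cstar_sqrt (b : A) : A :=
  xget 0 [set s : A | positive s /\ s ^+ 2 = b].

Definition cstar_abs (a : A) : A := cstar_sqrt (star a * a).

Definition bounded_functional (f : {scalar A}) : Prop :=
  exists M : R, forall x : A, modulus (f x) <= M * cnorm x.

Definition dual_norm (f : {scalar A}) : R :=
  sup [set modulus (f x) | x in [set x : A | cnorm x <= 1]].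

(* [0 <= z] in [R[i]] says that [z] is real and nonnegative. *)
Definition positive_functional (f : {scalar A}) : Prop :=
  forall b : A, positive b -> 0 <= f b.

(* The first condition is membership in the dual space; it makes the [sup] in
   [dual_norm f] range over a set that is bounded above. *)
Definition state_space : set {scalar A} :=
  [set f : {scalar A} | [/\ bounded_functional f, positive_functional f,
                            dual_norm f = 1 & f 1 = 1]].

Definition numerical_radius (a : A) : R :=
  sup [set modulus (f a) | f in state_space].

(* The value [f (star a * a)] is a nonnegative real for a state [f], so taking
   its real part only changes its type. *)
Definition dw_radius (a : A) : R :=
  sup [set Num.sqrt (modulus (f a) ^+ 2 + complex.Re (f (star a * a)) ^+ 2)
      | f in state_space].

End CStar.

(* Main.v *)
(* For a state [f], put [h = star a * a] and [z = f(h) h + conj(f(a)) a].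
   Cauchy-Schwarz [|f z|^2 <= f(star z * z)] gives the Boas-Bellman bound
     (|f a|^2 + f(h)^2)^2 <= f(h)^2 + f(h^2)^2 + 2 |f(h a)|^2
                          <= f(h^2) + f(h^4) + 2 |f(h a)|^2,
   and [h = |a|^2]. That [|a|] exists requires [h] to have a positive square
   root. Call a self-adjoint [x] nonnegative if [||r - x|| <= r] for some
   [r > 0]: such elements form a cone closed under square roots, computed by
   the iteration [y' = (k + y^2) / 2] with [k = 1 - x], which is dominated by
   the same iteration over the reals started with [k = 1]. Nonnegativity of
   [star a * a] is then proved without spectral theory, by ruling out a
   negative part. *)
Require Import Defs.
From mathcomp Require Import all_boot all_order all_algebra.
From mathcomp Require Import all_classical all_reals all_analysis.
From mathcomp Require Import ring lra.
Import Order.TTheory GRing.Theory Num.Theory.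
Set Implicit Arguments.
Unset Strict Implicit.
Unset Printing Implicit Defensive.
Local Open Scope classical_set_scope.
Local Open Scope complex_scope.
Local Open Scope ring_scope.

(** * The real-valued modulus on complex numbers *)

Section Modulus.
Variable R : realType.
Implicit Types (z : R[i]) (r : R).

Lemma modulusE z : modulus z = Num.sqrt (complex.Re z ^+ 2 + complex.Im z ^+ 2).
Proof. by case: z. Qed.

Lemma sqr_modulus z : modulus z ^+ 2 = complex.Re z ^+ 2 + complex.Im z ^+ 2.
Proof. by rewrite modulusE sqr_sqrtr // addr_ge0 // sqr_ge0. Qed.

Lemma modulus_ge0 z : 0 <= modulus z.
Proof. by rewrite modulusE sqrtr_ge0. Qed.

Lemma modulus_real r : modulus r%:C = `|r|.
Proof. by rewrite modulusE /= expr0n addr0 sqrtr_sqr. Qed.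

Lemma modulusM : {morph @modulus R : x y / x * y}.
Proof.
move=> [a b] [c d]; rewrite !modulusE -sqrtrM ?addr_ge0 ?sqr_ge0 //=.
congr Num.sqrt; ring.
Qed.

Lemma Re_le_modulus z : complex.Re z <= modulus z.
Proof.
apply: le_trans (ler_norm _) _; rewrite -ler_sqr ?nnegrE ?modulus_ge0 //.
by rewrite sqr_modulus real_normK ?num_real // lerDl sqr_ge0.
Qed.

End Modulus.

(** * Elementary rules for the norm and the involution *)

Section Norm.
Variables (R : realType) (A : cstarAlgType R).
Implicit Types (x y z : A) (r : R).

Lemma cnormZr r x : cnorm (r%:C *: x) = `|r| * cnorm x.
Proof. by rewrite cnormZ modulus_real. Qed.

Lemma cnorm0 : cnorm (0 : A) = 0.
Proof. by rewrite -[X in cnorm X](scale0r 0) (cnormZr 0) normr0 mul0r. Qed.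

Lemma cnormN x : cnorm (- x) = cnorm x.
Proof.
by rewrite -scaleN1r -(rmorphN1 (real_complex R)) cnormZr normrN1 mul1r.
Qed.

Lemma cnormB x y : cnorm (x - y) <= cnorm x + cnorm y.
Proof. by rewrite -(cnormN y) cnormD. Qed.

Lemma cnorm_distC x y : cnorm (x - y) = cnorm (y - x).
Proof. by rewrite -cnormN opprB. Qed.

Lemma cnorm_ge0 x : 0 <= cnorm x.
Proof. by have := cnormB x x; rewrite subrr cnorm0; lra. Qed.

Lemma star0 : star (0 : A) = 0.
Proof. by apply: (addrI (star 0)); rewrite -starD !addr0. Qed.

Lemma starN x : star (- x) = - star x.
Proof. by apply: (addrI (star x)); rewrite -starD !subrr star0. Qed.

Lemma starB x y : star (x - y) = star x - star y.
Proof. by rewrite starD starN. Qed.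

Lemma starZr r x : star (r%:C *: x) = r%:C *: star x.
Proof.
rewrite starZ; congr (_ *: _).
by apply/eqP; rewrite eq_complex /= oppr0 !eqxx.
Qed.

Lemma starZi x : star ('i *: x) = - ('i *: star x).
Proof.
rewrite starZ -scaleNr; congr (_ *: _).
by apply/eqP; rewrite eq_complex /= oppr0 !eqxx.
Qed.

Lemma star1 : star (1 : A) = 1.
Proof. by rewrite -[RHS]starK -[X in _ = star X]mulr1 starM starK mulr1. Qed.

Lemma cnorm_eq0P x : star x * x = 0 -> x = 0.
Proof.
move=> xx; apply: cnorm_eq0; apply/eqP.
by rewrite -sqrf_eq0 -cnorm_star xx cnorm0.
Qed.

Lemma cnorm1 : cnorm (1 : A) = 1.
Proof.
have n0 : cnorm (1 : A) != 0 by apply/eqP => /cnorm_eq0/eqP; rewrite oner_eq0.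
by apply: (mulfI n0); rewrite -expr2 -cnorm_star star1 !mulr1.
Qed.

Lemma cnorm_starE x : cnorm (star x) = cnorm x.
Proof.
suff le y : cnorm y <= cnorm (star y).
  by apply/eqP; rewrite eq_le le -{2}(starK x) le.
have [->|n0] := eqVneq (cnorm y) 0; first exact: cnorm_ge0.
have y0 : 0 < cnorm y by rewrite lt_def n0 cnorm_ge0.
by rewrite -(ler_pM2r y0) -expr2 -cnorm_star cnormM.
Qed.

Lemma cnorm_sqr x : star x = x -> cnorm (x * x) = cnorm x ^+ 2.
Proof. by move=> {1}<-; exact: cnorm_star. Qed.

Lemma starMC x y : star x = x -> star y = y -> GRing.comm x y ->
  star (x * y) = x * y.
Proof. by move=> sx sy xy; rewrite starM sx sy xy. Qed.

End Norm.

(** * Square roots near the unit, by iteration *)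

Section SquareRoot.
Variables (R : realType) (A : cstarAlgType R).
Implicit Types (x y z : A) (r : R).

(** A fixed point [l] satisfies [(1 - l)^2 = 1 - k]. *)
Fixpoint sqrt_iter (k : A) (n : nat) : A :=
  if n is m.+1 then (2^-1 : R)%:C *: (k + sqrt_iter k m * sqrt_iter k m) else 0.

Fixpoint sqrt_maj (n : nat) : R :=
  if n is m.+1 then 2^-1 * (1 + sqrt_maj m * sqrt_maj m) else 0.

Lemma sqrt_maj_bnd n : 0 <= sqrt_maj n <= 1.
Proof. elim: n => [|n /andP[]] /=; [lra | nra]. Qed.

Lemma sqrt_iter_comm k n x : GRing.comm x k -> GRing.comm x (sqrt_iter k n).
Proof.
move=> xk; elim: n => [|n IH] /=; first exact: commr0.
rewrite /GRing.comm -scalerAr -scalerAl; congr (_ *: _).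
by apply: commrD => //; apply: commrM.
Qed.

Lemma sqrt_iter_star k n : star k = k -> star (sqrt_iter k n) = sqrt_iter k n.
Proof.
by move=> sk; elim: n => [|n IH] /=; rewrite ?star0 // starZr starD starM sk IH.
Qed.

Lemma cnorm_sqrt_iter k n : cnorm k <= 1 -> cnorm (sqrt_iter k n) <= sqrt_maj n.
Proof.
move=> k1; elim: n => [|n IH] /=; first by rewrite cnorm0.
rewrite cnormZr ger0_norm ?invr_ge0 ?ler0n // ler_wpM2l ?invr_ge0 ?ler0n //.
apply: le_trans (cnormD _ _) _; apply: lerD => //.
by apply: le_trans (cnormM _ _) _; apply: ler_pM => //; exact: cnorm_ge0.
Qed.

Lemma sqr_sub_comm x y : GRing.comm x y -> x * x - y * y = (x - y) * (x + y).
Proof. by move=> xy; rewrite mulrBl !mulrDr xy opprD addrA addrK. Qed.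

(** Iterates commute, so a difference of squares factors as [(u - v) * (u + v)], and the majorant
    factors alike. Induction bounds [u - v], and [cnorm_sqrt_iter] bounds [u + v]. *)
Lemma sqrt_iter_step k n : cnorm k <= 1 ->
  cnorm (sqrt_iter k n.+1 - sqrt_iter k n) <= sqrt_maj n.+1 - sqrt_maj n.
Proof.
move=> k1; elim: n => [|n IH].
  rewrite /= !mul0r !addr0 !subr0 cnormZr ger0_norm ?invr_ge0 ?ler0n //.
  by rewrite ler_wpM2l ?invr_ge0 ?ler0n.
set u := sqrt_iter k n.+1; set v := sqrt_iter k n.
have -> : sqrt_iter k n.+2 - u = (2^-1 : R)%:C *: ((u - v) * (u + v)).
  rewrite -sqr_sub_comm; last by apply/sqrt_iter_comm/commr_sym/sqrt_iter_comm.
  by rewrite -[u * u - v * v](addrKA k) [u * u + k]addrC scalerBr.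
have -> : sqrt_maj n.+2 - sqrt_maj n.+1 =
    2^-1 * ((sqrt_maj n.+1 - sqrt_maj n) * (sqrt_maj n.+1 + sqrt_maj n)).
  by rewrite /=; ring.
rewrite cnormZr ger0_norm ?invr_ge0 ?ler0n // ler_wpM2l ?invr_ge0 ?ler0n //.
apply: le_trans (cnormM _ _) _; apply: ler_pM; rewrite ?cnorm_ge0 //.
by apply: le_trans (cnormD _ _) _; apply: lerD; exact: cnorm_sqrt_iter.
Qed.

Lemma sqrt_iter_dist k m n : cnorm k <= 1 -> (m <= n)%N ->
  cnorm (sqrt_iter k n - sqrt_iter k m) <= sqrt_maj n - sqrt_maj m.
Proof.
move=> k1 /subnK<-; elim: (n - m)%N => [|p IH].
  by rewrite !subrr cnorm0.
rewrite addSn -(subrKA (sqrt_iter k (p + m))) -(subrKA (sqrt_maj (p + m))).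
by apply: le_trans (cnormD _ _) _; apply: lerD => //; exact: sqrt_iter_step.
Qed.

Lemma sqrt_maj_cauchy (e : R) : 0 < e ->
  exists N, forall n, (N <= n)%N -> sqrt_maj n - sqrt_maj N < e.
Proof.
move=> e0; have ub : has_ubound (range sqrt_maj).
  by exists 1 => _ [n _ <-]; have /andP[] := sqrt_maj_bnd n.
have hs : has_sup (range sqrt_maj) by split => //; exists (sqrt_maj 0), 0.
have [_ [N _ <-] Ne] := sup_adherent e0 hs.
exists N => n _; have := ub_le_sup ub (imageT sqrt_maj n).
by lra.
Qed.

Lemma sqrt_iter_cvg k : cnorm k <= 1 ->
  exists l, forall e : R, 0 < e -> exists N, forall n, (N <= n)%N ->
    cnorm (sqrt_iter k n - l) < e.
Proof.
move=> k1; apply: cnorm_complete => e e0.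
have [|N HN] := @sqrt_maj_cauchy (e / 2); first lra.
exists N => m n Nm Nn; rewrite -(subrKA (sqrt_iter k N)).
apply: le_lt_trans (cnormD _ _) _; rewrite [X in _ + X]cnorm_distC.
have := sqrt_iter_dist k1 Nm; have := sqrt_iter_dist k1 Nn.
by have := HN _ Nm; have := HN _ Nn; lra.
Qed.

(** Passes identities to the limit: [z] is the defect of an identity at [l]. Two consecutive terms
    appear because the recursion links them. *)
Lemma cvg_cnorm_eq0 (u : nat -> A) l z (c : R) :
  (forall e : R, 0 < e -> exists N, forall n, (N <= n)%N ->
    cnorm (u n - l) < e) ->
  0 <= c ->
  (forall n, cnorm z <= c * (cnorm (u n - l) + cnorm (u n.+1 - l))) -> z = 0.
Proof.
move=> ul c0 zc; apply: cnorm_eq0; apply/eqP; rewrite eq_le cnorm_ge0 andbT.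
apply/ler_addgt0Pl => e e0; rewrite addr0.
(* The shift to [c + 1] keeps the divisor positive when [c = 0]. *)
have c1 : 0 < c + 1 by lra.
have [|N HN] := ul (e / (2 * (c + 1))); first by rewrite divr_gt0 // mulr_gt0.
have h1 := HN _ (leqnn N); have h2 := HN _ (leqnSn N).
have -> : e = (c + 1) * (e / (2 * (c + 1)) + e / (2 * (c + 1))).
  by field; lra.
apply: le_trans (zc N) _; apply: ler_pM; rewrite ?addr_ge0 ?cnorm_ge0 //; lra.
Qed.

(** The root is [1 - l], with [l] the limit of the iteration for [k = 1 - h]. The commutation clause
    stands in for membership of [s] in the closed subalgebra generated by [h]. *)
Lemma sqrt_near1 h : star h = h -> cnorm (1 - h) <= 1 ->
  exists s, [/\ star s = s, s * s = h, cnorm (1 - s) <= 1 &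
    forall x, GRing.comm x h -> GRing.comm x s].
Proof.
move=> sh k1; set k := 1 - h in k1.
have sk : star k = k by rewrite starB star1 sh.
have [l ul] := sqrt_iter_cvg k1.
have l1 : cnorm l <= 1.
  apply/ler_addgt0Pr => e /ul[N /(_ N (leqnn N)) HN].
  have := cnorm_sqrt_iter N k1; have /andP[_] := sqrt_maj_bnd N.
  have := cnormB (sqrt_iter k N) (sqrt_iter k N - l).
  by rewrite subKr; lra.
have comm_l x : GRing.comm x k -> GRing.comm x l.
  move=> xk; apply/eqP; rewrite -subr_eq0; apply/eqP.
  apply: (cvg_cnorm_eq0 (c := 2 * cnorm x) ul) => [|n].
    by rewrite mulr_ge0 // cnorm_ge0.
  have -> : x * l - l * x =
      (sqrt_iter k n - l) * x - x * (sqrt_iter k n - l).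
    by rewrite mulrBl mulrBr (sqrt_iter_comm n xk) [RHS]addrC opprB subrKA.
  have := cnormB ((sqrt_iter k n - l) * x) (x * (sqrt_iter k n - l)).
  have := cnormM (sqrt_iter k n - l) x; have := cnormM x (sqrt_iter k n - l).
  by have := cnorm_ge0 x; have := cnorm_ge0 (sqrt_iter k n.+1 - l); nra.
have sl : star l = l.
  apply/eqP; rewrite -subr_eq0; apply/eqP.
  apply: (cvg_cnorm_eq0 (c := 2) ul) => // n.
  have := cnormB (sqrt_iter k n - l) (star (sqrt_iter k n - l)).
  rewrite cnorm_starE starB (sqrt_iter_star n sk) [X in cnorm X]addrC opprB.
  by rewrite subrKA; have := cnorm_ge0 (sqrt_iter k n.+1 - l); lra.
have fl : l = (2^-1 : R)%:C *: (k + l * l).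
  apply/eqP; rewrite -subr_eq0; apply/eqP.
  apply: (cvg_cnorm_eq0 (c := 1) ul) => // n; set u := sqrt_iter k n.
  have -> : l - (2^-1 : R)%:C *: (k + l * l) =
      (2^-1 : R)%:C *: ((u - l) * (u + l)) - (sqrt_iter k n.+1 - l).
    rewrite -sqr_sub_comm; last by apply/comm_l/commr_sym/sqrt_iter_comm.
    rewrite -[u * u - l * l](addrKA k) [u * u + k]addrC scalerBr.
    by rewrite opprB [RHS]addrC subrKA.
  apply: le_trans (cnormB _ _) _; rewrite mul1r lerD2r.
  rewrite cnormZr ger0_norm ?invr_ge0 ?ler0n //.
  have := cnormM (u - l) (u + l); have := cnormD u l.
  have := cnorm_sqrt_iter n k1; have /andP[_] := sqrt_maj_bnd n.
  have := cnorm_ge0 (u - l); rewrite -/u; nra.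
exists (1 - l); split.
- by rewrite starB star1 sl.
- have -> : (1 - l) * (1 - l) = 1 - ((l + l) - l * l).
    by rewrite mulrBl mul1r mulrBr mulr1 -addrA -opprD addrA.
  suff -> : l + l = k + l * l by rewrite addrK subKr.
  rewrite {1 2}fl -scalerDl -rmorphD /=.
  have -> : 2^-1 + 2^-1 = 1 :> R by field.
  by rewrite scale1r.
- by rewrite subKr.
- move=> x xh; apply: commrB; first exact: commr1.
  by apply: comm_l; apply: commrB => //; exact: commr1.
Qed.

End SquareRoot.

Section Positivity.
Variables (R : realType) (A : cstarAlgType R).
Implicit Types (a b c h p q x y : A) (r : R).

(** In spectral terms: the spectrum of [h] lies in [[0, 2r]]. *)
Definition nonneg h :=
  star h = h /\ exists2 r, 0 < r & cnorm (r%:C *: 1 - h) <= r.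

(** Dividing by [r] reduces to [sqrt_near1]; [sqrt r] then rescales the root and serves as its
    radius. *)
Lemma nonneg_sqrt h : nonneg h -> exists s, [/\ nonneg s, s * s = h &
  forall x, GRing.comm x h -> GRing.comm x s].
Proof.
move=> [sh [r r0 hr]].
have rV0 : 0 < r^-1 by rewrite invr_gt0.
have [||s [ss s2 s1 sC]] := @sqrt_near1 R A (r^-1%:C *: h).
- by rewrite starZr sh.
- have -> : 1 - r^-1%:C *: h = r^-1%:C *: (r%:C *: 1 - h).
    by rewrite scalerBr scalerA -rmorphM /= mulVf ?scale1r // gt_eqF.
  rewrite cnormZr gtr0_norm // -(mulVf (lt0r_neq0 r0)).
  by rewrite ler_pM2l.
exists ((Num.sqrt r)%:C *: s); split.
- split; first by rewrite starZr ss.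
  exists (Num.sqrt r); first by rewrite sqrtr_gt0.
  rewrite -scalerBr cnormZr ger0_norm ?sqrtr_ge0 //.
  by rewrite -[leRHS]mulr1 ler_wpM2l ?sqrtr_ge0.
- rewrite -scalerAl -scalerAr scalerA -rmorphM /= -expr2 sqr_sqrtr ?ltW // s2.
  by rewrite scalerA -rmorphM /= divff ?scale1r // gt_eqF.
- move=> x xh; rewrite /GRing.comm -scalerAl -scalerAr; congr (_ *: _).
  by apply: sC; rewrite /GRing.comm -scalerAl -scalerAr xh.
Qed.

Lemma nonnegD p q : nonneg p -> nonneg q -> nonneg (p + q).
Proof.
move=> [sp [r r0 pr]] [sq [t t0 qt]]; split; first by rewrite starD sp sq.
exists (r + t); first by rewrite addr_gt0.
rewrite rmorphD /= scalerDl opprD addrACA.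
by apply: le_trans (cnormD _ _) _; exact: lerD.
Qed.

Lemma star_addZi x y : star x = x -> star y = y -> GRing.comm x y ->
  star (x + 'i *: y) * (x + 'i *: y) = x * x + y * y.
Proof.
move=> sx sy xy; rewrite starD starZi sx sy mulrDl !mulrDr.
rewrite !mulNr -!scalerAl -!scalerAr scalerA.
have -> : 'i * 'i = -1 :> R[i] by rewrite -expr2 sqr_i.
by rewrite scaleN1r opprK addrA xy addrK.
Qed.

(* Completing [x] to the unitary [x + i * sqrt (1 - x^2)] bounds the norm of
   [1 - x^2 = c^2] with no spectral theory. *)
Lemma cnorm_1Bsqr x : star x = x -> cnorm x <= 1 -> cnorm (1 - x * x) <= 1.
Proof.
move=> sx x1.
have [||c [sc c2 _ cC]] := @sqrt_near1 R A (1 - x * x).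
- by rewrite starB star1 starM sx.
- by rewrite subKr cnorm_sqr // expr_le1 // cnorm_ge0.
have xc : GRing.comm x c.
  by apply: cC; apply: commrB; [exact: commr1 | apply: commrM].
set u := x + 'i *: c.
have u1 : cnorm u <= 1.
  rewrite -(@expr_le1 _ 2) ?cnorm_ge0 // -cnorm_star star_addZi // c2.
  by rewrite addrC subrK cnorm1.
(* [c] is the imaginary part of [u], so [||u|| <= 1] gives [||c|| <= 1]. *)
have cu : 'i *: c + 'i *: c = u - star u.
  by rewrite /u starD starZi sx sc opprD opprK addrACA subrr add0r.
rewrite -c2 cnorm_sqr // expr_le1 ?cnorm_ge0 //.
have := cnormB u (star u); rewrite cnorm_starE -cu -scalerDl cnormZ.
suff -> : modulus ('i + 'i : R[i]) = 2 by lra.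
by rewrite modulusE /= addr0 expr0n add0r sqrtr_sqr ger0_norm.
Qed.

Lemma nonneg_sqr x : star x = x -> nonneg (x * x).
Proof.
move=> sx; split; first by rewrite starM sx.
(* Adding 1 keeps the scaling factor positive even for [x = 0]. *)
have x0 : 0 < cnorm x + 1 by have := cnorm_ge0 x; lra.
set r := cnorm x + 1 in x0 *; exists (r ^+ 2); first by rewrite exprn_gt0.
have sy : star (r^-1%:C *: x) = r^-1%:C *: x by rewrite starZr sx.
have y1 : cnorm (r^-1%:C *: x) <= 1.
  by rewrite cnormZr gtr0_norm ?invr_gt0 // ler_pdivrMl // mulr1 /r; lra.
have := cnorm_1Bsqr sy y1.
have -> : 1 - (r^-1%:C *: x) * (r^-1%:C *: x) =
    (r ^+ 2)^-1%:C *: ((r ^+ 2)%:C *: 1 - x * x).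
  rewrite -scalerAl -scalerAr scalerBr !scalerA -!rmorphM /= mulVf.
    by rewrite scale1r -expr2 exprVn.
  by rewrite lt0r_neq0 // exprn_gt0.
have r2 : 0 < r ^+ 2 by rewrite exprn_gt0.
by rewrite cnormZr gtr0_norm ?invr_gt0 // ler_pdivrMl // mulr1.
Qed.

(** Commuting roots [s] of [h] and [t] of [- h] give [star u * u = s^2 + t^2 = 0] for [u = s + i t].
    Then [u] and [star u] vanish, hence so does [s]. *)
Lemma nonneg_anti h : nonneg h -> nonneg (- h) -> h = 0.
Proof.
move=> ph nh; have [s [[ss _] s2 sC]] := nonneg_sqrt ph.
have [t [[st _] t2 tC]] := nonneg_sqrt nh.
have st_comm : GRing.comm s t.
  by apply: tC; apply: commrN; rewrite -s2; apply: commrM.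
have u0 : s + 'i *: t = 0.
  by apply: cnorm_eq0P; rewrite star_addZi // s2 t2 subrr.
have u0' : s - 'i *: t = 0.
  by have := congr1 star u0; rewrite starD starZi ss st star0.
have s0 : s *+ 2 = 0 by rewrite mulr2n -{1}(subrK ('i *: t) s) u0' add0r addrC.
have {}s0 : s = 0.
  have : 2%:R *: s = 0 :> A by rewrite scaler_nat.
  by move/eqP; rewrite scaler_eq0 pnatr_eq0 => /eqP.
by rewrite -s2 s0 mul0r.
Qed.

Lemma nonnegD_eq0 p q : nonneg p -> nonneg q -> p + q = 0 -> p = 0.
Proof.
move=> pp pq /eqP; rewrite addr_eq0 => /eqP pE; apply: nonneg_anti => //.
by rewrite pE opprK.
Qed.

(** The element is the sum of the squares of the self-adjoints [c + star c] and [i (c - star c)];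
    the doubling avoids fractions. *)
Lemma nonneg_starDmul c :
  nonneg ((star c * c + c * star c) + (star c * c + c * star c)).
Proof.
set N := star c * c + c * star c.
have -> : N + N = (c + star c) * (c + star c) +
    ('i *: (c - star c)) * ('i *: (c - star c)).
  rewrite -scalerAl -scalerAr scalerA.
  have -> : 'i * 'i = -1 :> R[i] by rewrite -expr2 sqr_i.
  have -> : (c + star c) * (c + star c) = N + (c * c + star c * star c).
    rewrite mulrDl !mulrDr [star c * c + _]addrC addrACA addrC.
    by rewrite [X in X + _]addrC.
  have -> : (c - star c) * (c - star c) = c * c + star c * star c - N.
    rewrite mulrBl !mulrBr opprB addrACA.
    by rewrite -opprD [_ + star c * c]addrC.
  by rewrite scaleN1r opprB [RHS]addrACA subrr addr0.
apply: nonnegD; apply: nonneg_sqr; first by rewrite starD starK addrC.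
by rewrite starZi starB starK -scalerN opprB.
Qed.

(* With [- star b * b = s^2], both [star c * c] and [c * star c] are [<= 0] for
   [c = b * s], while twice their sum is a sum of squares of self-adjoints. *)
Lemma star_mul_npos b : nonneg (- (star b * b)) -> b = 0.
Proof.
move=> /nonneg_sqrt[s [[ss _] s2 _]]; set p := s * s; set q := b * star b.
have sp : star p = p by rewrite starM ss.
have sq : star q = q by rewrite starM starK.
have := nonneg_starDmul (b * s); rewrite starM ss.
(* For [c = b * s] this reads [star c * c = - p^2] and [c * star c = - q^2]. *)
have -> : s * star b * (b * s) + b * s * (s * star b) = - (p * p + q * q).
  rewrite opprD /q; congr (_ + _).
    rewrite -!mulrA [star b * _]mulrA -[star b * b]opprK -s2.
    by rewrite mulNr mulrN -!mulrA.
  by rewrite -!mulrA [s * (s * _)]mulrA s2 mulNr mulrN -!mulrA.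
set M := p * p + q * q => nM.
have pM : nonneg M by apply: nonnegD; apply: nonneg_sqr.
(* [M + M] and its negative are both nonnegative, so [M + M = 0]. *)
have M0 : M = 0.
  apply: (nonnegD_eq0 pM pM); apply: nonneg_anti; first exact: nonnegD.
  by rewrite opprD.
have p0 : p = 0.
  apply: cnorm_eq0P; rewrite sp.
  by apply: nonnegD_eq0 M0; apply: nonneg_sqr.
by apply: cnorm_eq0P; apply/eqP; rewrite -oppr_eq0 -s2 -/p p0.
Qed.

(* With [h = star a * a] and [k = sqrt (h^2)], the element [d = k - h] is twice
   the negative part of [h], and [star (a * d) * (a * d) = - d * k * d]. *)
Lemma nonneg_star_mul a : nonneg (star a * a).
Proof.
set h := star a * a; have sh : star h = h by rewrite starM starK.
have [k [pk k2 kC]] := nonneg_sqrt (nonneg_sqr sh).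
have [r [[sr _] r2 rC]] := nonneg_sqrt pk; have [sk _] := pk.
have hk : GRing.comm h k by apply: kC; apply: commrM.
set d := k - h; have sd : star d = d by rewrite starB sk sh.
have dr : GRing.comm d r.
  by apply: rC; apply/commr_sym/commrB => //; exact: commr_sym.
(* This is [(k - h) (k + h) = k^2 - h^2 = 0]. *)
have dk : d * k = - (d * h).
  apply/eqP; rewrite -addr_eq0 -mulrDr /d -sqr_sub_comm; last exact: commr_sym.
  by rewrite k2 subrr.
have ad : star (a * d) * (a * d) = d * h * d.
  by rewrite starM sd -!mulrA [star a * _]mulrA.
have drd : d * k * d = (d * r) * (d * r) by rewrite -r2 -!mulrA -dr.
(* [- d h d = d k d = (d r)^2] is the square of a self-adjoint element. *)
have ad0 : a * d = 0.
  apply: star_mul_npos; rewrite ad -mulNr -dk drd; apply: nonneg_sqr.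
  exact: starMC.
have dhd : d * h * d = 0 by rewrite -ad ad0 mulr0.
(* Both [d h d] and [d k d = - d h d] vanish. The norm identity then descends from [d^4 = 0] to
   [d^2 = 0] and to [d = 0], that is, [h = k]. *)
have d3 : d * d * d = 0.
  have -> : d * d * d = d * k * d - d * h * d by rewrite -mulrBl -mulrBr.
  by rewrite dk mulNr dhd oppr0 addr0.
have d2 : d * d = 0.
  by apply: cnorm_eq0P; rewrite starM sd mulrA d3 mul0r.
have d0 : d = 0 by apply: cnorm_eq0P; rewrite sd.
by move/eqP: d0; rewrite subr_eq0 => /eqP <-.
Qed.

Lemma cstar_abs_sqr a : cstar_abs a ^+ 2 = star a * a.
Proof.
have [s [ps s2 _]] := nonneg_sqrt (nonneg_star_mul a).
(* The second root exhibits [s] as [star t * t], the form that [positive] demands. *)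
have [t [[st _] t2 _]] := nonneg_sqrt ps.
rewrite /cstar_abs /cstar_sqrt.
case: (xgetP 0 [set s | positive s /\ s ^+ 2 = star a * a]) => [s' _ [] //|].
by move=> /(_ s) []; split; [exists t; rewrite st | rewrite expr2].
Qed.

End Positivity.

(** * Inequalities for a single state *)

Section States.
Variables (R : realType) (A : cstarAlgType R) (f : {scalar A}).
Hypothesis fS : state_space f.
Implicit Types (x y z : A) (c : R[i]).

Lemma modulus_state x : modulus (f x) <= cnorm x.
Proof.
have [[M fM] _ f1 _] := fS.
have [x0|x0] := eqVneq (cnorm x) 0.
  rewrite (cnorm_eq0 _ x0) linear0 cnorm0 modulusE /=.
  by rewrite expr0n addr0 sqrtr0.
have xp : 0 < cnorm x by rewrite lt_def x0 cnorm_ge0.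
have : modulus (f ((cnorm x)^-1%:C *: x)) <= 1.
  rewrite -f1; apply: ub_le_sup; last first.
    exists ((cnorm x)^-1%:C *: x) => //=.
    by rewrite cnormZr gtr0_norm ?invr_gt0 // mulVf.
  (* The absolute value covers a negative [M]. *)
  exists `|M| => _ [y /= y1 <-]; apply: le_trans (fM y) _.
  apply: le_trans (ler_wpM2r (cnorm_ge0 _) (ler_norm M)) _.
  by rewrite -[leRHS]mulr1 ler_wpM2l.
rewrite linearZ /= modulusM modulus_real gtr0_norm ?invr_gt0 //.
by rewrite ler_pdivrMl // mulr1.
Qed.

Lemma state_star_mul x :
  complex.Im (f (star x * x)) = 0 /\ 0 <= complex.Re (f (star x * x)).
Proof.
have [_ fp _ _] := fS; have := fp _ (ex_intro _ x erefl).
by rewrite lecE /= => /andP[/eqP-> ->].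
Qed.

Lemma state_star_mulD x y c :
  f (star (x + c *: y) * (x + c *: y)) =
  f (star x * x) + c * f (star x * y) + Num.conj c * f (star y * x) +
  Num.conj c * c * f (star y * y).
Proof.
have fZ d u : f (d *: u) = d * f u by exact: linearZ.
have -> : star (x + c *: y) * (x + c *: y) = star x * x + c *: (star x * y) +
    (Num.conj c *: (star y * x) + (Num.conj c * c) *: (star y * y)).
  by rewrite starD starZ mulrDl !mulrDr -!scalerAl -!scalerAr scalerA.
by rewrite !linearD !fZ !addrA.
Qed.

(** [f] is real at [star y * y]: taking [y = 1 + x] settles the imaginary part, and [y = 1 + i x]
    the real part. *)
Lemma state_star x : f (star x) = Num.conj (f x).
Proof.
have [_ _ _ f1] := fS.
have [h1 _] := state_star_mul (1 + 1 *: x).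
have [h2 _] := state_star_mul (1 + 'i *: x).
have [h3 _] := state_star_mul x.
move: h1 h2; rewrite !state_star_mulD star1 !mul1r !mulr1 f1.
move: (f x) (f (star x)) h3 => [p q] [u v]; case: (f _) => g1 g2 /= -> h1 h2.
by apply/eqP; rewrite eq_complex /=; apply/andP; split; apply/eqP; lra.
Qed.

(** Positivity of [f] at [z - f(z) 1] says that the variance [f(star z * z) - |f(z)|^2] is
    nonnegative. *)
Lemma state_cauchy z : modulus (f z) ^+ 2 <= complex.Re (f (star z * z)).
Proof.
have [_ _ _ f1] := fS.
have [_] := state_star_mul (z + (- f z) *: 1).
rewrite state_star_mulD star1 !mul1r !mulr1 f1 state_star sqr_modulus.
by case: (f z) => p q; case: (f _) => g1 g2 /=; lra.
Qed.

(* The Boas-Bellman inequality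
   (|<u,a>|^2 + |<u,h>|^2)^2 <= |<a,a>|^2 + |<h,h>|^2 + 2 |<a,h>|^2
   for the unit vector [u = 1] and the semi-inner product [f (star y * x)]. *)
Lemma state_davis_wielandt a (h := star a * a) :
  (modulus (f a) ^+ 2 + complex.Re (f h) ^+ 2) ^+ 2 <=
  complex.Re (f (h ^+ 2)) + complex.Re (f (h ^+ 4)) +
  2 * modulus (f (h * a)) ^+ 2.
Proof.
have hE : star a * a = h by [].
have sh : star h = h by rewrite starM starK.
clearbody h.
have sh2 : star (h ^+ 2) = h ^+ 2 by rewrite starM sh.
have fZ d u : f (d *: u) = d * f u by exact: linearZ.
have [h_im h_ge0] := state_star_mul a.
have [h2_im _] := state_star_mul h.
have hC := state_cauchy h; have h2C := state_cauchy (h ^+ 2).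
have := state_cauchy ((complex.Re (f h))%:C *: h + Num.conj (f a) *: a).
rewrite state_star_mulD starZr sh.
(* Both cross terms are thus expressed through [f (h * a)]. *)
have -> : star a * ((complex.Re (f h))%:C *: h) =
    star ((complex.Re (f h))%:C *: (h * a)).
  by rewrite starZr starM sh -scalerAr.
rewrite state_star linearD -!scalerAl -!scalerAr !fZ.
move: h_im h_ge0 h2_im hC h2C.
rewrite sh sh2 -!expr2 -exprM hE !sqr_modulus.
move: (f a) (f h) (f (h ^+ 2)) (f (h ^+ 4)) (f (h * a)).
move=> [p q] [B b] [G g] [K k] [u v] /= -> B0 -> hC h2C zC.
have BG : B ^+ 2 <= G by lra.
have GK : G ^+ 2 <= K by lra.
(* In real coordinates, [D] is [f(z)] and [T] is [f(star z * z)]. *)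
set m := p ^+ 2 + q ^+ 2; set D := m + B ^+ 2.
set T := B ^+ 2 * G + 2 * B * (p * u + q * v) + m * B.
set S := B ^+ 2 + G ^+ 2 + 2 * (u ^+ 2 + v ^+ 2).
have DT : D ^+ 2 <= T by move: zC; rewrite /D /T /m; lra.
(* Cauchy-Schwarz via Lagrange's identity: [T] is the dot product of [(G, B, sqrt 2 u, sqrt 2 v)]
   and [(B^2, m, sqrt 2 B p, sqrt 2 B q)], whose squared lengths are [S] and [D^2]. *)
have TS : T ^+ 2 <= S * D ^+ 2.
  rewrite -subr_ge0.
  have -> : S * D ^+ 2 - T ^+ 2 = (B ^+ 3 - G * m) ^+ 2 +
      2 * (B ^+ 2 * p - u * m) ^+ 2 + 2 * (B ^+ 2 * q - v * m) ^+ 2 +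
      2 * (G * B * p - u * B ^+ 2) ^+ 2 + 2 * (G * B * q - v * B ^+ 2) ^+ 2 +
      4 * (u * B * q - v * B * p) ^+ 2.
    by rewrite /S /D /T /m; ring.
  by rewrite !addr_ge0 ?sqr_ge0 // mulr_ge0 ?sqr_ge0.
(* Divide [D^4 <= T^2 <= S D^2] by [D^2]; the case [D^2 = 0] is separate. *)
have D2 : D ^+ 2 <= S.
  have := sqr_ge0 D; rewrite le_eqVlt => /orP[/eqP<-|D0].
    by rewrite /S !addr_ge0 ?sqr_ge0 // mulr_ge0 // addr_ge0 ?sqr_ge0.
  rewrite -(ler_pM2r D0) -expr2; apply: le_trans TS.
  by rewrite ler_sqr ?nnegrE ?sqr_ge0 // (le_trans (sqr_ge0 D)).
by apply: le_trans D2 _; rewrite /S; lra.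
Qed.

End States.

(** * Passage to suprema over all states *)

Lemma state_le_numerical_radius (R : realType) (A : cstarAlgType R)
  (f : {scalar A}) (x : A) :
  state_space f -> modulus (f x) <= numerical_radius x.
Proof.
move=> fS; apply: ub_le_sup; last by exists f.
by exists (cnorm x) => _ [g gS <-]; exact: modulus_state.
Qed.

Unset Implicit Arguments.

Theorem theorem3p13 (R : realType) (A : cstarAlgType R) (a : A) :
  dw_radius a ^+ 2 <=
  Num.sqrt (numerical_radius (cstar_abs a ^+ 4 + cstar_abs a ^+ 8) +
            2 * numerical_radius (cstar_abs a ^+ 2 * a) ^+ 2).
Proof.
(* Apart from [a] itself, only even powers of [|a|] occur, so everything reduces to powers of
   [star a * a]. *)
have abs_pow n : cstar_abs a ^+ (2 * n) = (star a * a) ^+ n.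
  by rewrite exprM cstar_abs_sqr.
rewrite (abs_pow 2) (abs_pow 4) (abs_pow 1) expr1.
set h := star a * a; set W := _ + _.
have dwf f : state_space f ->
    modulus (f a) ^+ 2 + complex.Re (f h) ^+ 2 <= Num.sqrt W.
  move=> fS; rewrite -ler_sqr ?nnegrE ?sqrtr_ge0 ?addr_ge0 ?sqr_ge0 //.
  have fW : (modulus (f a) ^+ 2 + complex.Re (f h) ^+ 2) ^+ 2 <= W.
    apply: le_trans (state_davis_wielandt fS a) _; apply: lerD.
      apply: le_trans (state_le_numerical_radius _ fS).
      rewrite linearD; apply: le_trans (Re_le_modulus _).
      by case: (f _); case: (f _).
    rewrite ler_wpM2l // ler_sqr ?nnegrE ?modulus_ge0 //.
      exact: state_le_numerical_radius.
    exact: le_trans (modulus_ge0 _) (state_le_numerical_radius _ fS).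
  by rewrite sqr_sqrtr // (le_trans (sqr_ge0 _) fW).
(* Without states, [dw_radius a] is the supremum of the empty set, which is 0 by convention. *)
have [[f fS]|noS] := pselect (state_space (A := A) !=set0); last first.
  have S0 : state_space (A := A) = set0.
    by apply/seteqP; split => // f fS; apply: noS; exists f.
  by rewrite /dw_radius S0 image_set0 sup0 expr0n sqrtr_ge0.
have dw_le : dw_radius a <= Num.sqrt (Num.sqrt W).
  apply: ge_sup; first exact/image_nonempty/(ex_intro _ f fS).
  by move=> _ [g gS <-]; apply: ler_wsqrtr; exact: dwf.
have dw_ge0 : 0 <= dw_radius a.
  apply: le_trans (sqrtr_ge0 (modulus (f a) ^+ 2 + complex.Re (f h) ^+ 2)) _.
  apply: ub_le_sup; last by exists f.
  exists (Num.sqrt (Num.sqrt W)) => _ [g gS <-].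
  by apply: ler_wsqrtr; exact: dwf.
by rewrite -[leRHS]sqr_sqrtr ?sqrtr_ge0 // ler_sqr ?nnegrE ?sqrtr_ge0.
Qed.
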